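(* Let $N=2r+1$ with $r\ge 1$, and let $SO(N)_2$ be the unitary modular category with simple objects $\{1, Z, X_1,\dots,X_r, X_\epsilon, X_{\epsilon'}\}$ and the fusion rules listed in the context. Then for each $1\le i\le r$ the simple object $X_i$ is a $(2,3,1)$-gYBE object with respect to the set $S=\{X_\epsilon,X_{\epsilon'}\}$; that is, $X_\epsilon$ and $X_{\epsilon'}$ are non-isomorphic simple objects and $$X_i\otimes X_\epsilon\cong X_\epsilon\oplus X_{\epsilon'},\qquad X_i\otimes X_{\epsilon'}\cong X_\epsilon\oplus X_{\epsilon'}.$$
   Context: $(d,3,1)$-gYBE object: an object $X$ (not necessarily simple) of a ribbon fusion category $\mathcal{C}$ is called a $(d,3,1)$-gYBE object with respect to a set of objects $S=\{X_i\}_{i\in I}$ of $\mathcal{C}$ if the $X_i$, $i\in I$, are $d$ simple objects of distinct isomorphism types such that $X\otimes X_i\cong\bigoplus_{j\in I}X_j$ for each $i\in I$. For $N=2r+1$, $r\ge 1$, $SO(N)_2$ is a unitary modular category (in particular a ribbon fusion category, so its tensor product is commutative up to isomorphism) of rank $r+4$, with pairwise non-isomorphic simple objects $1$ (the unit), $Z$, $X_1,\dots,X_r$, $X_\epsilon$, $X_{\epsilon'}$, all of whose fusion rules follow from: (i) $X_\epsilon\otimes X_\epsilon\cong 1\oplus\bigoplus_{i=1}^r X_i$; (ii) $X_\epsilon\otimes X_i\cong X_\epsilon\oplus X_{\epsilon'}$ for $1\le i\le r$; (iii) $X_\epsilon\otimes X_{\epsilon'}\cong Z\oplus\bigoplus_{i=1}^r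 X_i$; (iv) $Z\otimes X_\epsilon\cong X_{\epsilon'}$; (v) $Z\otimes Z\cong 1$; (vi) $Z\otimes X_i\cong X_i$ for $1\le i\le r$; (vii) $X_i\otimes X_i\cong 1\oplus Z\oplus X_{\min\{2i,\,2r+1-2i\}}$ for $1\le i\le r$; (viii) $X_i\otimes X_j\cong X_{j-i}\oplus X_{\min\{i+j,\,2r+1-i-j\}}$ for $1\le i<j\le r$. *)

(* Defs.v *)
From HB Require Import structures.
From mathcomp Require Import all_boot all_order all_algebra.
From mathcomp Require Import reals complex.

Set Implicit Arguments.
Unset Strict Implicit.
Unset Printing Implicit Defensive.

Import Order.TTheory GRing.Theory Num.Theory.
Local Open Scope ring_scope.

Declare Scope cat_scope.
Delimit Scope cat_scope with cat.
Local Open Scope cat_scope.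

Reserved Notation "g ∘ f" (at level 40, left associativity).
Reserved Notation "X ≅ Y" (at level 70, no associativity).
Reserved Notation "X ⊕ Y" (at level 50, left associativity).
Reserved Notation "X ⊗ Y" (at level 40, left associativity).
Reserved Notation "f ⊠ g" (at level 40, left associativity).

Record linearCat (K : fieldType) := LinearCat {
  obj :> Type;
  mor : obj -> obj -> vectType K;
  idm : forall X, mor X X;
  compm : forall X Y Z, mor Y Z -> mor X Y -> mor X Z;
  compmA : forall W X Y Z (h : mor Y Z) (g : mor X Y) (f : mor W X),
    compm h (compm g f) = compm (compm h g) f;
  comp1m : forall X Y (f : mor X Y), compm (idm Y) f = f;
  compm1 : forall X Y (f : mor X Y), compm f (idm X) = f;
  comp_linearl : forall X Y Z a (g g' : mor Y Z) (f : mor X Y),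
    compm (a *: g + g') f = a *: compm g f + compm g' f;
  comp_linearr : forall X Y Z a (g : mor Y Z) (f f' : mor X Y),
    compm g (a *: f + f') = a *: compm g f + compm g f'
}.
Arguments mor {K l} X Y.
Arguments idm {K l} X.
Arguments compm {K l X Y Z} g f.
Notation "g ∘ f" := (compm g f) : cat_scope.

Section LinearCatTheory.
Context {K : fieldType} {C : linearCat K}.
Implicit Types V W X Y Z : C.

Record isom X Y := Isom {
  fwd : mor X Y;
  bwd : mor Y X;
  fwdK : bwd ∘ fwd = idm X;
  bwdK : fwd ∘ bwd = idm Y
}.

Definition isomorphic X Y : Prop := inhabited (isom X Y).

Definition is_iso X Y (f : mor X Y) : Prop :=
  exists g : mor Y X, g ∘ f = idm X /\ f ∘ g = idm Y.

Definition is_mono X Y (f : mor X Y) : Prop :=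
  forall V (g h : mor V X), f ∘ g = f ∘ h -> g = h.

Definition is_epi X Y (f : mor X Y) : Prop :=
  forall V (g h : mor Y V), g ∘ f = h ∘ f -> g = h.

Definition is_kernel W X Y (k : mor W X) (f : mor X Y) : Prop :=
  f ∘ k = 0 /\
  forall V (g : mor V X), f ∘ g = 0 -> exists! h : mor V W, k ∘ h = g.

Definition is_cokernel X Y W (q : mor Y W) (f : mor X Y) : Prop :=
  q ∘ f = 0 /\
  forall V (g : mor Y V), g ∘ f = 0 -> exists! h : mor W V, h ∘ q = g.

Definition simple X : Prop :=
  idm X <> 0 /\
  forall Y (f : mor Y X), is_mono f -> f = 0 \/ is_iso f.

Definition pairwise_nonisomorphic (I : Type) (F : I -> C) : Prop :=
  forall i j, isomorphic (F i) (F j) -> i = j.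

Definition simple_representatives (I : finType) (F : I -> C) : Prop :=
  [/\ forall i, simple (F i),
      pairwise_nonisomorphic F
    & forall X, simple X -> exists i, isomorphic X (F i)].

End LinearCatTheory.
Notation "X ≅ Y" := (isomorphic X Y) : cat_scope.

(* The vanishing of [prl_ ∘ inr_] and [prr_ ∘ inl_] follows from [prl_inl],
   [prr_inr] and [osum_id]. *)
Record abelianCat (K : fieldType) := AbelianCat {
  ab_linear :> linearCat K;
  ozero : ab_linear;
  ozeroP : idm ozero = 0;
  osum : ab_linear -> ab_linear -> ab_linear;
  inl_ : forall X Y, mor X (osum X Y);
  inr_ : forall X Y, mor Y (osum X Y);
  prl_ : forall X Y, mor (osum X Y) X;
  prr_ : forall X Y, mor (osum X Y) Y;
  prl_inl : forall X Y, prl_ X Y ∘ inl_ X Y = idm X;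
  prr_inr : forall X Y, prr_ X Y ∘ inr_ X Y = idm Y;
  osum_id : forall X Y,
    inl_ X Y ∘ prl_ X Y + inr_ X Y ∘ prr_ X Y = idm (osum X Y);
  has_kernel : forall (X Y : ab_linear) (f : mor X Y),
    exists W (k : mor W X), is_kernel k f;
  has_cokernel : forall (X Y : ab_linear) (f : mor X Y),
    exists W (q : mor Y W), is_cokernel q f;
  mono_normal : forall (W X : ab_linear) (k : mor W X), is_mono k ->
    exists Y (f : mor X Y), is_kernel k f;
  epi_normal : forall (Y W : ab_linear) (q : mor Y W), is_epi q ->
    exists X (f : mor X Y), is_cokernel q f
}.
Arguments ozero {K a}.
Arguments osum {K a} X Y.
Notation "X ⊕ Y" := (osum X Y) : cat_scope.
Notation "\bigoplus_ ( i < n ) F" := (\big[osum/ozero]_(i < n) F%cat)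
  (at level 41, i at level 50, n at level 50) : cat_scope.
Notation "\bigoplus_ ( m <= i < n ) F" :=
  (\big[osum/ozero]_(m <= i < n) F%cat)
  (at level 41, m, i, n at level 50) : cat_scope.
Notation "\bigoplus_ ( i : T ) F" := (\big[osum/ozero]_(i : T) F%cat)
  (at level 41, i at level 50, only parsing) : cat_scope.

Definition semisimple {K : fieldType} (C : abelianCat K) : Prop :=
  forall X : C, exists n (F : 'I_n -> C),
    (forall i, simple (F i)) /\ X ≅ \bigoplus_(i < n) F i.

Record monoidalCat (K : fieldType) := MonoidalCat {
  mon_abelian :> abelianCat K;
  unit_ob : mon_abelian;
  ten : mon_abelian -> mon_abelian -> mon_abelian;
  tenm : forall X X' Y Y' : mon_abelian,
    mor X X' -> mor Y Y' -> mor (ten X Y) (ten X' Y');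
  tenm_id : forall X Y : mon_abelian,
    tenm (idm X) (idm Y) = idm (ten X Y);
  tenm_comp : forall (X X' X'' Y Y' Y'' : mon_abelian)
      (f' : mor X' X'') (f : mor X X') (g' : mor Y' Y'') (g : mor Y Y'),
    tenm (f' ∘ f) (g' ∘ g) = tenm f' g' ∘ tenm f g;
  tenm_linearl : forall (X X' Y Y' : mon_abelian) a
      (f f' : mor X X') (g : mor Y Y'),
    tenm (a *: f + f') g = a *: tenm f g + tenm f' g;
  tenm_linearr : forall (X X' Y Y' : mon_abelian) a
      (f : mor X X') (g g' : mor Y Y'),
    tenm f (a *: g + g') = a *: tenm f g + tenm f g';
  assoc : forall X Y Z : mon_abelian,
    isom (ten (ten X Y) Z) (ten X (ten Y Z));
  assoc_natural : forall (X X' Y Y' Z Z' : mon_abelian)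
      (f : mor X X') (g : mor Y Y') (h : mor Z Z'),
    fwd (assoc X' Y' Z') ∘ tenm (tenm f g) h =
    tenm f (tenm g h) ∘ fwd (assoc X Y Z);
  lunit : forall X : mon_abelian, isom (ten unit_ob X) X;
  lunit_natural : forall (X Y : mon_abelian) (f : mor X Y),
    fwd (lunit Y) ∘ tenm (idm unit_ob) f = f ∘ fwd (lunit X);
  runit : forall X : mon_abelian, isom (ten X unit_ob) X;
  runit_natural : forall (X Y : mon_abelian) (f : mor X Y),
    fwd (runit Y) ∘ tenm f (idm unit_ob) = f ∘ fwd (runit X);
  pentagon : forall W X Y Z : mon_abelian,
    fwd (assoc W X (ten Y Z)) ∘ fwd (assoc (ten W X) Y Z) =
    tenm (idm W) (fwd (assoc X Y Z)) ∘ fwd (assoc W (ten X Y) Z)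
      ∘ tenm (fwd (assoc W X Y)) (idm Z);
  triangle : forall X Y : mon_abelian,
    tenm (idm X) (fwd (lunit Y)) ∘ fwd (assoc X unit_ob Y) =
    tenm (fwd (runit X)) (idm Y)
}.
Arguments unit_ob {K m}.
Arguments ten {K m} X Y.
Arguments tenm {K m X X' Y Y'} f g.
Arguments assoc {K m} X Y Z.
Arguments lunit {K m} X.
Arguments runit {K m} X.
Notation "X ⊗ Y" := (ten X Y) : cat_scope.
Notation "f ⊠ g" := (tenm f g) : cat_scope.

Section DualMorphism.
Context {K : fieldType} {C : monoidalCat K}.

(* [dX] stands for a left dual of [X], with coevaluation [bX]; [dY] for one
   of [Y], with evaluation [eY]. *)
Definition transpose (X Y dX dY : C)
    (bX : mor unit_ob (X ⊗ dX)) (eY : mor (dY ⊗ Y) unit_ob)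
    (f : mor X Y) : mor dY dX :=
  fwd (lunit dX) ∘ (eY ⊠ idm dX) ∘ bwd (assoc dY Y dX)
    ∘ (idm dY ⊠ (f ⊠ idm dX)) ∘ (idm dY ⊠ bX) ∘ bwd (runit dY).

End DualMorphism.

(* Only left duals are given: together with the braiding and the twist they
   yield right duals and a pivotal structure. *)
Record ribbonFusionCat (K : fieldType) := RibbonFusionCat {
  rib_monoidal :> monoidalCat K;
  unit_simple : simple (unit_ob : rib_monoidal);
  rib_semisimple : semisimple rib_monoidal;
  finitely_many_simples : exists n (F : 'I_n -> rib_monoidal),
    simple_representatives F;
  dual : rib_monoidal -> rib_monoidal;
  ev : forall X : rib_monoidal, mor (dual X ⊗ X) unit_ob;
  coev : forall X : rib_monoidal, mor unit_ob (X ⊗ dual X);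
  zigzag : forall X : rib_monoidal,
    fwd (runit X) ∘ (idm X ⊠ ev X) ∘ fwd (assoc X (dual X) X)
      ∘ (coev X ⊠ idm X) ∘ bwd (lunit X) = idm X;
  zigzag_dual : forall X : rib_monoidal,
    fwd (lunit (dual X)) ∘ (ev X ⊠ idm (dual X))
      ∘ bwd (assoc (dual X) X (dual X))
      ∘ (idm (dual X) ⊠ coev X) ∘ bwd (runit (dual X)) = idm (dual X);
  braid : forall X Y : rib_monoidal, isom (X ⊗ Y) (Y ⊗ X);
  braid_natural : forall (X X' Y Y' : rib_monoidal)
      (f : mor X X') (g : mor Y Y'),
    fwd (braid X' Y') ∘ (f ⊠ g) = (g ⊠ f) ∘ fwd (braid X Y);
  hexagon : forall X Y Z : rib_monoidal,
    fwd (assoc Y Z X) ∘ fwd (braid X (Y ⊗ Z)) ∘ fwd (assoc X Y Z) =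
    (idm Y ⊠ fwd (braid X Z)) ∘ fwd (assoc Y X Z)
      ∘ (fwd (braid X Y) ⊠ idm Z);
  hexagonV : forall X Y Z : rib_monoidal,
    bwd (assoc Z X Y) ∘ fwd (braid (X ⊗ Y) Z) ∘ bwd (assoc X Y Z) =
    (fwd (braid X Z) ⊠ idm Y) ∘ bwd (assoc X Z Y)
      ∘ (idm X ⊠ fwd (braid Y Z));
  twist : forall X : rib_monoidal, isom X X;
  twist_natural : forall (X Y : rib_monoidal) (f : mor X Y),
    fwd (twist Y) ∘ f = f ∘ fwd (twist X);
  twist_ten : forall X Y : rib_monoidal,
    fwd (twist (X ⊗ Y)) =
    fwd (braid Y X) ∘ fwd (braid X Y) ∘ (fwd (twist X) ⊠ fwd (twist Y));
  twist_dual : forall X : rib_monoidal,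
    fwd (twist (dual X)) = transpose (coev X) (ev X) (fwd (twist X))
}.
Arguments dual {K r} X.
Arguments ev {K r} X.
Arguments coev {K r} X.
Arguments braid {K r} X Y.
Arguments twist {K r} X.

Definition qtrace {K : fieldType} {C : ribbonFusionCat K} (X : C)
    (f : mor X X) : mor (unit_ob : C) unit_ob :=
  ev X ∘ fwd (braid X (dual X)) ∘ ((fwd (twist X) ∘ f) ⊠ idm (dual X))
    ∘ coev X.

(* The entries of the S-matrix live in End(1) = K id. *)
Record modularCat (K : fieldType) := ModularCat {
  modular_ribbon :> ribbonFusionCat K;
  Smatrix_unit : forall n (F : 'I_n -> modular_ribbon),
    simple_representatives F ->
    exists S : 'M[K]_n, S \in unitmx /\
      forall i j, qtrace (fwd (braid (F j) (F i)) ∘ fwd (braid (F i) (F j)))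
                  = S i j *: idm unit_ob
}.

(* Unitary structure in the sense of Turaev: a positive conjugation compatible
   with the ribbon structure. Turaev works with strict categories; here the
   associators and unitors are also required to be unitary. *)
Record unitaryModularCat (K : numClosedFieldType) := UnitaryModularCat {
  umc_modular :> modularCat K;
  dag : forall X Y : umc_modular, mor X Y -> mor Y X;
  dagK : forall (X Y : umc_modular) (f : mor X Y), dag (dag f) = f;
  dag_antilinear : forall (X Y : umc_modular) a (f g : mor X Y),
    dag (a *: f + g) = a^* *: dag f + dag g;
  dag_comp : forall (X Y Z : umc_modular) (g : mor Y Z) (f : mor X Y),
    dag (g ∘ f) = dag f ∘ dag g;
  dag_ten : forall (X X' Y Y' : umc_modular) (f : mor X X') (g : mor Y Y'),
    dag (f ⊠ g) = dag f ⊠ dag g;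
  dag_assoc : forall X Y Z : umc_modular,
    dag (fwd (assoc X Y Z)) = bwd (assoc X Y Z);
  dag_lunit : forall X : umc_modular, dag (fwd (lunit X)) = bwd (lunit X);
  dag_runit : forall X : umc_modular, dag (fwd (runit X)) = bwd (runit X);
  dag_braid : forall X Y : umc_modular,
    dag (fwd (braid X Y)) = bwd (braid X Y);
  dag_twist : forall X : umc_modular, dag (fwd (twist X)) = bwd (twist X);
  dag_coev : forall X : umc_modular,
    dag (coev X) =
    ev X ∘ fwd (braid X (dual X)) ∘ (fwd (twist X) ⊠ idm (dual X));
  dag_ev : forall X : umc_modular,
    dag (ev X) =
    (idm (dual X) ⊠ bwd (twist X)) ∘ bwd (braid (dual X) X) ∘ coev X;
  dag_positive : forall (X Y : umc_modular) (f : mor X Y),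
    exists2 a : K, 0 <= a & qtrace (f ∘ dag f) = a *: idm unit_ob
}.

Section SON2.
Context {K : numClosedFieldType} {C : unitaryModularCat K}.

(* Only [X 1], ..., [X r] are meaningful. *)
Record SO_odd_2 (r : nat) (Z : C) (X : nat -> C) (Xe Xe' : C) : Prop := {
  SO_simples : simple_representatives (fun k : 'I_(r + 4) =>
    nth unit_ob ([:: unit_ob; Z; Xe; Xe'] ++ [seq X i | i <- iota 1 r]) k);
  SO_ee : Xe ⊗ Xe ≅ unit_ob ⊕ \bigoplus_(1 <= i < r.+1) X i;
  SO_ei : forall i, (1 <= i <= r)%N -> Xe ⊗ X i ≅ Xe ⊕ Xe';
  SO_ee' : Xe ⊗ Xe' ≅ Z ⊕ \bigoplus_(1 <= i < r.+1) X i;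
  SO_Ze : Z ⊗ Xe ≅ Xe';
  SO_ZZ : Z ⊗ Z ≅ unit_ob;
  SO_Zi : forall i, (1 <= i <= r)%N -> Z ⊗ X i ≅ X i;
  SO_ii : forall i, (1 <= i <= r)%N ->
    X i ⊗ X i ≅ unit_ob ⊕ Z ⊕ X (minn (2 * i) (2 * r + 1 - 2 * i));
  SO_ij : forall i j, (1 <= i)%N -> (i < j)%N -> (j <= r)%N ->
    X i ⊗ X j ≅ X (j - i)%N ⊕ X (minn (i + j) (2 * r + 1 - i - j))
}.

End SON2.

Definition gYBE_31_object {K : fieldType} {C : ribbonFusionCat K} (d : nat)
    (X : C) (I : finType) (S : I -> C) : Prop :=
  [/\ #|I| = d,
      forall i, simple (S i),
      pairwise_nonisomorphic S
    & forall i, X ⊗ S i ≅ \bigoplus_(j : I) S j].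

(* Main.v *)
Require Import Defs.
From mathcomp Require Import all_boot all_order all_algebra.
From mathcomp Require Import reals complex.
Local Open Scope ring_scope.
Local Open Scope cat_scope.

(* Tensoring with [X_i] absorbs [Z], and [X_ε' ≅ Z ⊗ X_ε], so
   [X_i ⊗ X_ε' ≅ (X_i ⊗ Z) ⊗ X_ε ≅ X_i ⊗ X_ε ≅ X_ε ⊗ X_i ≅ X_ε ⊕ X_ε'],
   the braiding being used to commute tensor factors. *)

(** The product with [Xe] is a fusion rule read through the braiding; the product with [Xe'] reduces
    to it by [ten_absorb], taking [W] to be [Z]. Simplicity and non-isomorphism come from
    [SO_simples]. The remaining lemmas make isomorphism an equivalence relation compatible with [⊕]
    and [⊗], and [osum_ozero] reconciles [Xe ⊕ Xe'] with the iterated sum in [gYBE_31_object]. *)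

Section LinearCat.
Context {K : fieldType} {C : linearCat K}.
Implicit Types X Y Z : C.

Lemma compmDl X Y Z (g g' : mor Y Z) (f : mor X Y) :
  (g + g') ∘ f = g ∘ f + g' ∘ f.
Proof. by have := comp_linearl 1 g g' f; rewrite !GRing.scale1r. Qed.

Lemma compmDr X Y Z (g : mor Y Z) (f f' : mor X Y) :
  g ∘ (f + f') = g ∘ f + g ∘ f'.
Proof. by have := comp_linearr 1 g f f'; rewrite !GRing.scale1r. Qed.

Lemma comp0m X Y Z (f : mor X Y) : (0 : mor Y Z) ∘ f = 0.
Proof.
by apply: (@GRing.addrI _ (0 ∘ f)); rewrite -compmDl !GRing.addr0.
Qed.

Lemma compm0 X Y Z (g : mor Y Z) : g ∘ (0 : mor X Y) = 0.
Proof.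
by apply: (@GRing.addrI _ (g ∘ 0)); rewrite -compmDr !GRing.addr0.
Qed.

Lemma isomorphic_refl X : X ≅ X.
Proof. by constructor; exists (idm X) (idm X); rewrite comp1m. Qed.

Lemma isomorphic_sym X Y : X ≅ Y -> Y ≅ X.
Proof. by case=> -[f g gf fg]; constructor; exists g f. Qed.

Lemma isomorphic_trans Y X Z : X ≅ Y -> Y ≅ Z -> X ≅ Z.
Proof.
case=> -[f g gf fg] [[f' g' gf' fg']]; constructor.
exists (f' ∘ f) (g ∘ g').
  by rewrite compmA -(compmA g) gf' compm1.
by rewrite compmA -(compmA f') fg compm1.
Qed.

End LinearCat.

Section DirectSum.
Context {K : fieldType} {C : abelianCat K}.
Implicit Types X Y : C.

(** Inserting the decomposition [osum_id] of the identity between the two maps shows that the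
    composite [a] satisfies [a + a = a]. *)
Lemma prl_inr X Y : prl_ X Y ∘ inr_ X Y = 0.
Proof.
apply: (@GRing.addrI _ (prl_ X Y ∘ inr_ X Y)); rewrite GRing.addr0.
rewrite -[in RHS](comp1m (inr_ X Y)) -osum_id compmDl compmDr.
by rewrite -(compmA (inr_ X Y)) prr_inr compm1 !compmA prl_inl comp1m.
Qed.

Lemma prr_inl X Y : prr_ X Y ∘ inl_ X Y = 0.
Proof.
apply: (@GRing.addrI _ (prr_ X Y ∘ inl_ X Y)); rewrite GRing.addr0.
rewrite -[in RHS](comp1m (inl_ X Y)) -osum_id compmDl compmDr.
by rewrite -(compmA (inl_ X Y)) prl_inl compm1 !compmA prr_inr comp1m.
Qed.

Definition osumm {X X' Y Y'} (f : mor X X') (g : mor Y Y') :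
    mor (X ⊕ Y) (X' ⊕ Y') :=
  inl_ X' Y' ∘ f ∘ prl_ X Y + inr_ X' Y' ∘ g ∘ prr_ X Y.

Lemma osumm_id X Y : osumm (idm X) (idm Y) = idm (X ⊕ Y).
Proof. by rewrite /osumm !compm1 osum_id. Qed.

Lemma osumm_comp X X' X'' Y Y' Y'' (f' : mor X' X'') (f : mor X X')
    (g' : mor Y' Y'') (g : mor Y Y') :
  osumm f' g' ∘ osumm f g = osumm (f' ∘ f) (g' ∘ g).
Proof.
rewrite /osumm compmDl !compmDr !compmA.
rewrite -!(compmA _ (prl_ X' Y')) -!(compmA _ (prr_ X' Y')).
by rewrite prl_inl prr_inr prl_inr prr_inl !compm1 !compm0 !comp0m
  GRing.addr0 GRing.add0r.
Qed.

Lemma isomorphic_osum X X' Y Y' : X ≅ X' -> Y ≅ Y' -> X ⊕ Y ≅ X' ⊕ Y'.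
Proof.
case=> -[f f' f'f ff'] [[g g' g'g gg']]; constructor.
by exists (osumm f g) (osumm f' g');
  rewrite osumm_comp ?f'f ?g'g ?ff' ?gg' osumm_id.
Qed.

(** Every map into [ozero] vanishes because its identity does, so [osum_id] reduces to the term
    through [X]. *)
Lemma osum_ozero X : X ⊕ ozero ≅ X.
Proof.
constructor; exists (prl_ X ozero) (inl_ X ozero); last exact: prl_inl.
rewrite -[RHS]osum_id -[in RHS](comp1m (prr_ X ozero)) ozeroP comp0m.
by rewrite compm0 GRing.addr0.
Qed.

End DirectSum.

Section Tensor.
Context {K : fieldType}.

Lemma isomorphic_ten (C : monoidalCat K) (X X' Y Y' : C) :
  X ≅ X' -> Y ≅ Y' -> X ⊗ Y ≅ X' ⊗ Y'.
Proof.
case=> -[f f' f'f ff'] [[g g' g'g gg']]; constructor.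
by exists (f ⊠ g) (f' ⊠ g');
  rewrite -tenm_comp ?f'f ?g'g ?ff' ?gg' tenm_id.
Qed.

Lemma isomorphic_tenA (C : monoidalCat K) (X Y Z : C) :
  (X ⊗ Y) ⊗ Z ≅ X ⊗ (Y ⊗ Z).
Proof. exact: inhabits (assoc X Y Z). Qed.

Lemma isomorphic_tenC (C : ribbonFusionCat K) (X Y : C) : X ⊗ Y ≅ Y ⊗ X.
Proof. exact: inhabits (braid X Y). Qed.

(** Replace [Y'] by [W ⊗ Y], reassociate, and let [X] absorb [W] after braiding [X ⊗ W] into
    [W ⊗ X]. *)
Lemma ten_absorb (C : ribbonFusionCat K) (W X Y Y' : C) :
  W ⊗ X ≅ X -> W ⊗ Y ≅ Y' -> X ⊗ Y' ≅ X ⊗ Y.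
Proof.
move=> WX WY.
apply: (isomorphic_trans (X ⊗ (W ⊗ Y))).
  by apply: isomorphic_ten (isomorphic_refl X) (isomorphic_sym _ _ WY).
apply: isomorphic_trans (isomorphic_sym _ _ (isomorphic_tenA _ _ _ _)) _.
apply: isomorphic_ten (isomorphic_refl Y).
exact: isomorphic_trans (isomorphic_tenC _ _ _) WX.
Qed.

End Tensor.

Theorem theorem2p6 (R : realType) (r : nat) (hr : (1 <= r)%N)
    (C : unitaryModularCat R[i]) (Z : C) (X : nat -> C) (Xe Xe' : C)
    (hC : SO_odd_2 r Z X Xe Xe') (i : nat) (hi : (1 <= i <= r)%N) :
  [/\ gYBE_31_object 2 (X i) (tnth [tuple Xe; Xe']),
      [/\ simple Xe, simple Xe' & ~ Xe ≅ Xe'],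
      X i ⊗ Xe ≅ Xe ⊕ Xe'
    & X i ⊗ Xe' ≅ Xe ⊕ Xe'].
Proof.
have [simpleF nonisoF _] := SO_simples hC.
(* Counting from 0, [Xe] and [Xe'] sit at positions 2 and 3 in the list of simples. *)
have lt2 : (2 < r + 4)%N by rewrite addnC.
have lt3 : (3 < r + 4)%N by rewrite addnC.
have sXe : simple Xe := simpleF (Ordinal lt2).
have sXe' : simple Xe' := simpleF (Ordinal lt3).
have XeXe' : ~ Xe ≅ Xe'.
  by move=> /(nonisoF (Ordinal lt2) (Ordinal lt3)) /(congr1 val).
have XiXe : X i ⊗ Xe ≅ Xe ⊕ Xe'.
  exact: isomorphic_trans (isomorphic_tenC _ _ _) (SO_ei hC hi).
have XiXe' : X i ⊗ Xe' ≅ Xe ⊕ Xe'.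
  exact: isomorphic_trans (ten_absorb _ _ _ _ _ (SO_Zi hC hi) (SO_Ze hC)) XiXe.
split=> //; split; first by rewrite card_ord.
- by case=> [[|[|//]] lt].
- case=> [[|[|//]] lt] [[|[|//]] lt'] iso; try exact: val_inj.
  (* Only the index pair (1, 0) is left: equal indices are settled by [val_inj], and for (0, 1)
     [iso] contradicts [XeXe'] as it stands. *)
  by case: XeXe'; exact: isomorphic_sym iso.
- have sumS : Xe ⊕ Xe' ≅ \bigoplus_(j : 'I_2) tnth [tuple Xe; Xe'] j.
    (* The iterated sum unfolds to [Xe ⊕ (Xe' ⊕ ozero)], whose trailing zero object has to be
       removed. *)
    rewrite !big_ord_recl big_ord0; apply: isomorphic_osum.
      exact: isomorphic_refl.
    exact: isomorphic_sym (osum_ozero _).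
  by case=> [[|[|//]] lt]; apply: isomorphic_trans sumS.
Qed.
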